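(* Let $\varepsilon\ge 0$ and suppose that $\Sigma_{\mathrm{pk}}$ is uniformly discrete. Let $k\in\{1,\dots,n\}$ be such that $\Sigma_{\mathrm{pk}}\subseteq\Sigma^{(k)}$. Let $T\ge k+1$ and $u_{[0,T-1]}\in\mathbb{R}^{mT}$. If $$\left\|\begin{bmatrix}F & G\end{bmatrix}M_{A,B}^{(k)}D_A^{(k)}\mathcal{H}_{k+1}(u_{[0,T-1]})\right\|>\varepsilon\sqrt{T}\,\|d_A^{(k)}\|_1\left(2+\|M_{A,I}^{(k)}\|\,\|F\|\sqrt{n+1}\right)$$ for all $(A,B)\in\Sigma_{\mathrm{pk}}$ and all nonzero $(F,G)\in\Sigma_{\mathrm{pk}}-\Sigma_{\mathrm{pk}}$, then $u_{[0,T-1]}$ is $\Sigma_{\mathrm{pk}}$-universal for identification.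
   Context: Let $n,m\in\mathbb{N}$, $\varepsilon\ge 0$, and $\Sigma=\mathbb{R}^{n\times n}\times\mathbb{R}^{n\times m}$. $\|\cdot\|$ is the Euclidean norm for vectors and spectral norm for matrices, $\|\cdot\|_1$ the vector 1-norm. A signal $u(0),\dots,u(T-1)\in\mathbb{R}^m$ is identified with the stacked vector $u_{[0,T-1]}\in\mathbb{R}^{mT}$; similarly for $x_{[0,T]}$. For $T\in\mathbb{N}$ and $(A,B)\in\Sigma$, $\mathfrak{B}_T(A,B)$ is the set of all pairs $(u_{[0,T-1]},x_{[0,T]})$, with $u(t)\in\mathbb{R}^m$, $x(t)\in\mathbb{R}^n$, for which there exist $w(0),\dots,w(T-1)\in\mathbb{R}^n$ with $\|w(t)\|\le\varepsilon$ and $x(t+1)=Ax(t)+Bu(t)+w(t)$ for $t=0,\dots,T-1$. $\mathfrak{B}(A,B,u_{[0,T-1]})$ is the set of those elements of $\mathfrak{B}_T(A,B)$ whose input part equals the given $u_{[0,T-1]}$. For a dataset $\mathcal{D}$, $\Sigma_{\mathcal{D}}=\{(A,B)\in\Sigma\mid \mathcal{D}\in\mathfrak{B}_T(A,B)\}$. $\Sigma_{\mathrm{pk}}\subseteq\Sigma$ is the prior knowledge set (it contains the unknown true system, hence is nonempty), and $\Sigma_{\mathrm{pk}}-\Sigma_{\mathrm{pk}}$ is the set of all differences of two of its elements. $\Sigma_{\mathrm{pk}}$ is uniformly discrete if $\delta_{\mathrm{pk}}>0$, where $\delta_{\mathrm{pk}}=\inf\{\|[F\ \ G]\|\neq 0\mid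 (F,G)\in\Sigma_{\mathrm{pk}}-\Sigma_{\mathrm{pk}}\}$ (with $\inf\emptyset=+\infty$). A dataset $\mathcal{D}\in\mathfrak{B}_T(A,B)$ with $(A,B)\in\Sigma_{\mathrm{pk}}$ is $\Sigma_{\mathrm{pk}}$-informative for identification if $\Sigma_{\mathcal{D}}\cap\Sigma_{\mathrm{pk}}$ is a singleton. An input $u_{[0,T-1]}$ is $\Sigma_{\mathrm{pk}}$-universal for identification if every $\mathcal{D}\in\bigcup_{(A,B)\in\Sigma_{\mathrm{pk}}}\mathfrak{B}(A,B,u_{[0,T-1]})$ is $\Sigma_{\mathrm{pk}}$-informative for identification. For $1\le k\le T$, the Hankel matrix $\mathcal{H}_k(u_{[0,T-1]})$ of depth $k$ is the $mk\times(T-k+1)$ matrix whose $j$-th column ($j=0,\dots,T-k$) is the stacked vector of $u(j),\dots,u(j+k-1)$. $\Sigma^{(k)}$ is the set of $(A,B)\in\Sigma$ such that the minimal polynomial of $A$ has degree at most $k$. For $(A,B)\in\Sigma^{(k)}$, let $d_0,\dots,d_k\in\mathbb{R}$ satisfy $\sum_{i=0}^k d_iA^i=0$ and $d_k=1$ (if not unique, one such choice is fixed for each $A$; for $k=n$ the coefficients of the characteristic polynomial), and define $d_A^{(k)}=[d_0\ \cdots\ d_k]^\top$, $$M_{A,B}^{(k)}=\begin{bmatrix}0 & B & AB & \cdots & A^{k-1}B\\ I_m & 0 & 0 & \cdots & 0\end{bmatrix},\quad M_{A,I}^{(k)}=\begin{bmatrix}0 & I_n & A & \cdots & A^{k-1}\\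 I_n & 0 & 0 & \cdots & 0\end{bmatrix},\quad D_A^{(k)}=\begin{bmatrix} d_0 & \cdots & d_{k-1} & d_k\\ d_1 & \cdots & d_k & 0\\ \vdots & & \vdots & \vdots\\ d_k & \cdots & 0 & 0\end{bmatrix}\otimes I_m$$ (the $(i,j)$ entry, $i,j=0,\dots,k$, of the left Kronecker factor is $d_{i+j}$ if $i+j\le k$ and $0$ otherwise). *)

(* Defs.v *)
From HB Require Import structures.
From mathcomp Require Import all_boot all_order all_algebra.
From mathcomp Require Import all_classical all_reals.
From mathcomp Require Import ereal.
From mathcomp.real_closed Require Import mxtens.

Set Implicit Arguments.
Unset Strict Implicit.
Unset Printing Implicit Defensive.

Import Order.TTheory GRing.Theory Num.Theory.
Local Open Scope classical_set_scope.
Local Open Scope ring_scope.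

Definition enorm (R : realType) (p : nat) (x : 'cV[R]_p) : R :=
  Num.sqrt (\sum_(i < p) x i 0 ^+ 2).

Definition norm1 (R : realType) (p : nat) (x : 'cV[R]_p) : R :=
  \sum_(i < p) `|x i 0|.

(* Operator norm induced by the Euclidean norms; the supremum is over a
   nonempty bounded set (it contains 0), also when p = 0 or q = 0. *)
Definition specnorm (R : realType) (p q : nat) (M : 'M[R]_(p, q)) : R :=
  sup [set enorm (M *m x) | x in [set x : 'cV[R]_q | enorm x <= 1]].

(* Sigma: a pair S = (A, B) is the system x(t+1) = A x(t) + B u(t) + w(t). *)
Notation system R n m := ('M[R]_n * 'M[R]_(n, m))%type.

(* A signal on [0, T-1] is a T-tuple of column vectors; its value at time t is
   the tuple entry u`_t. A dataset is a pair (u_[0,T-1], x_[0,T]). *)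
Notation signal R p T := (T.-tuple 'cV[R]_p).
Notation dataset R n m T := (signal R m T * signal R n T.+1)%type.

Definition behavior (R : realType) (n m T : nat) (eps : R)
    (S : system R n m) : set (dataset R n m T) :=
  [set D : dataset R n m T | exists w : signal R n T, forall t : nat, (t < T)%N ->
     enorm w`_t <= eps /\
     (D.2)`_(t.+1) = S.1 *m (D.2)`_t + S.2 *m (D.1)`_t + w`_t].

Definition behavior_in (R : realType) (n m T : nat) (eps : R)
    (S : system R n m) (u : signal R m T) : set (dataset R n m T) :=
  [set D : dataset R n m T | behavior eps S D /\ D.1 = u].

Definition consistent (R : realType) (n m T : nat) (eps : R)
    (D : dataset R n m T) : set (system R n m) :=
  [set S : system R n m | behavior eps S D].

Definition informative (R : realType) (n m T : nat) (eps : R)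
    (Spk : set (system R n m)) (D : dataset R n m T) : Prop :=
  exists S : system R n m, consistent eps D `&` Spk = [set S].

Definition universal (R : realType) (n m T : nat) (eps : R)
    (Spk : set (system R n m)) (u : signal R m T) : Prop :=
  forall D : dataset R n m T,
    (\bigcup_(S in Spk) behavior_in eps S u) D -> informative eps Spk D.

Definition differences (R : realType) (n m : nat) (Spk : set (system R n m)) :
    set (system R n m) :=
  [set S1 - S2 | S1 in Spk & S2 in Spk].

Definition delta_pk (R : realType) (n m : nat) (Spk : set (system R n m)) :
    \bar R :=
  ereal_inf [set r%:E | r in
    [set specnorm (row_mx FG.1 FG.2) | FG in differences Spk] `&`
    [set r : R | r != 0]].

Definition uniformly_discrete (R : realType) (n m : nat)
    (Spk : set (system R n m)) : Prop :=
  (0 < delta_pk Spk)%E.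

(* Stacked index convention: p : 'I_(k * m) is entry (mxtens_unindex p).2 of
   block (mxtens_unindex p).1, i.e. p = block * m + entry. This is also the
   convention of the Kronecker product *t of mxtens. *)

(* Meaningful for 1 <= k <= T, in which case j + block < T for every entry. *)
Definition hankel (R : realType) (m T k : nat) (u : signal R m T) :
    'M[R]_(k * m, T - k + 1) :=
  \matrix_(p, j) u`_(j + (mxtens_unindex p).1) (mxtens_unindex p).2 0.

(* [ B  AB ... A^(k-1)B ] *)
Definition powers_row (R : realType) (n m k : nat)
    (A : 'M[R]_n) (B : 'M[R]_(n, m)) : 'M[R]_(n, k * m) :=
  \matrix_(i, q) (A ^+ (mxtens_unindex q).1 *m B) i (mxtens_unindex q).2.

(* M_{A,B}^(k); M_{A,I}^(k) is Mmx k A 1%:M.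
   The width k.+1 * m is convertible to m + k * m. *)
Definition Mmx (R : realType) (n m k : nat)
    (A : 'M[R]_n) (B : 'M[R]_(n, m)) : 'M[R]_(n + m, k.+1 * m) :=
  block_mx 0 (powers_row k A B) 1%:M 0.

(* D_A^(k), for d = d_A^(k) *)
Definition Dmx (R : realType) (m k : nat) (d : 'cV[R]_k.+1) :
    'M[R]_(k.+1 * m, k.+1 * m) :=
  (\matrix_(i < k.+1, j < k.+1)
     if (i + j <= k)%N then d (inord (i + j)) 0 else 0) *t (1%:M : 'M[R]_m).

(* The library's minimal polynomial is only available in dimension n.+1. *)
Definition Sigma_deg (R : realType) (n m k : nat) : set (system R n.+1 m) :=
  [set S : system R n.+1 m | (degree_mxminpoly S.1 <= k)%N].

(* d fixes, for each A admissible in Sigma_deg, one choice of d_A^(k). *)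
Definition annihilator_choice (R : realType) (n k : nat)
    (d : 'M[R]_n.+1 -> 'cV[R]_k.+1) : Prop :=
  forall A : 'M[R]_n.+1, (degree_mxminpoly A <= k)%N ->
    [/\ \sum_(i < k.+1) d A i 0 *: A ^+ i = 0,
        d A ord_max 0 = 1
      & k = n.+1 -> forall i : 'I_k.+1, d A i 0 = (char_poly A)`_i].

(* Main.v *)
Require Import Defs.
From HB Require Import structures.
From mathcomp Require Import all_boot all_order all_algebra.
From mathcomp Require Import all_classical all_reals.
From mathcomp.real_closed Require Import mxtens.
From mathcomp Require Import ring lra zify.

Set Implicit Arguments.
Unset Strict Implicit.
Unset Printing Implicit Defensive.

Import Order.TTheory GRing.Theory Num.Theory.
Local Open Scope classical_set_scope.
Local Open Scope ring_scope.

(** Suppose that two systems (A, B) and (A', B') of the prior knowledge set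
    explain the same data, with disturbances w and w', and put F = A' - A and
    G = B' - B.  Subtracting the two state equations gives
    F x(t) + G u(t) = w(t) - w'(t), so the combination F x + G u has norm at most
    2 eps at every time, although nothing is known about F x alone.

    The state is eliminated with the annihilating polynomial of A.  Let d_0, ...,
    d_k be its coefficients.  Expanding x(j+i) by the variation of constants
    formula, the contribution of x(j) to sum_i d_i x(j+i) is
    (sum_i d_i A^i) x(j) = 0, so that this sum depends only on the inputs and
    disturbances on the window [j, j+k] ([shift_comb_state]).  The matrices
    M_{A,B} and D_A are precisely the bookkeeping of that expansion
    ([Dmx_block_col], [Mmx_block_col]): column j of
    [F G] M_{A,B} D_A H_{k+1}(u) equals

      sum_i d_i (F x(j+i) + G u(j+i))  -  F [I 0] M_{A,I} D_A H_{k+1}(w)_j.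

    The first sum has norm at most 2 eps |d|_1.  Each of the k+1 blocks of the
    vector D_A H_{k+1}(w)_j is a combination of disturbances with coefficients
    among the d_i, hence of norm at most eps |d|_1, and the whole vector has norm
    at most sqrt(k+1) eps |d|_1.  This bounds every column, and the spectral norm
    of a matrix with T - k columns is at most sqrt(T - k) times the largest norm
    of a column ([specnorm_le_col]).  Since k <= n, the outcome contradicts the
    assumed strict lower bound unless (F, G) = 0. *)

(** * Euclidean and spectral norms *)

(** Cauchy-Schwarz, from the identity of Lagrange that writes the defect as half
    of the sum of the squares (a_i b_j - a_j b_i)^2. *)
Lemma sum_mul_sqr_le (R : realDomainType) (I : finType) (a b : I -> R) :
  (\sum_i a i * b i) ^+ 2 <= (\sum_i a i ^+ 2) * (\sum_i b i ^+ 2).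
Proof.
have lagrange : \sum_i \sum_j (a i * b j - a j * b i) ^+ 2 =
    ((\sum_i a i ^+ 2) * (\sum_i b i ^+ 2) - (\sum_i a i * b i) ^+ 2) *+ 2.
  transitivity (\sum_i \sum_j (a i ^+ 2 * b j ^+ 2)
      + \sum_i \sum_j (a j ^+ 2 * b i ^+ 2)
      - (\sum_i \sum_j (a i * b i) * (a j * b j)) *+ 2).
    rewrite -sumrMnl -big_split -sumrB /=; apply: eq_bigr => i _.
    rewrite -sumrMnl -big_split -sumrB /=; apply: eq_bigr => j _; ring.
  rewrite -exchange_big /= -!mulr2n -mulrnBl; congr (_ *+ _).
  rewrite big_distrlr /= expr2 big_distrlr /=; congr (_ - _).
  by rewrite exchange_big.
have : 0 <= \sum_i \sum_j (a i * b j - a j * b i) ^+ 2.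
  by apply: sumr_ge0 => i _; apply: sumr_ge0 => j _; apply: sqr_ge0.
by rewrite lagrange pmulrn_lge0 // subr_ge0.
Qed.

Section EuclideanNorm.
Variable R : realType.
Implicit Types p q : nat.

Lemma enorm_ge0 p (x : 'cV[R]_p) : 0 <= enorm x.
Proof. exact: sqrtr_ge0. Qed.

Lemma enorm_sqr p (x : 'cV[R]_p) : enorm x ^+ 2 = \sum_i x i 0 ^+ 2.
Proof. by rewrite sqr_sqrtr // sumr_ge0 // => i _; apply: sqr_ge0. Qed.

Lemma enorm_le p (x : 'cV[R]_p) (c : R) :
  0 <= c -> \sum_i x i 0 ^+ 2 <= c ^+ 2 -> enorm x <= c.
Proof.
by move=> c0; rewrite -enorm_sqr ler_pXn2r // nnegrE // enorm_ge0.
Qed.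

Lemma enorm0 p : enorm (0 : 'cV[R]_p) = 0.
Proof.
by rewrite /enorm big1 ?sqrtr0 // => i _; rewrite mxE expr0n.
Qed.

Lemma enormZ p (a : R) (x : 'cV[R]_p) : enorm (a *: x) = `|a| * enorm x.
Proof.
rewrite /enorm -sqrtr_sqr -sqrtrM ?sqr_ge0 // mulr_sumr.
by congr Num.sqrt; apply: eq_bigr => i _; rewrite mxE exprMn.
Qed.

Lemma enormN p (x : 'cV[R]_p) : enorm (- x) = enorm x.
Proof. by rewrite -scaleN1r enormZ normrN normr1 mul1r. Qed.

Lemma enormD p (x y : 'cV[R]_p) : enorm (x + y) <= enorm x + enorm y.
Proof.
apply: enorm_le; first by rewrite addr_ge0 // enorm_ge0.
have cs : \sum_i x i 0 * y i 0 <= enorm x * enorm y.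
  apply: le_trans (ler_norm _) _.
  rewrite -(ler_pXn2r (n := 2)) // ?nnegrE ?mulr_ge0 ?enorm_ge0 //.
  by rewrite real_normK ?num_real // exprMn !enorm_sqr sum_mul_sqr_le.
have -> : \sum_i (x + y) i 0 ^+ 2 =
    enorm x ^+ 2 + (\sum_i x i 0 * y i 0) *+ 2 + enorm y ^+ 2.
  rewrite !enorm_sqr -sumrMnl -!big_split /=; apply: eq_bigr => i _.
  by rewrite mxE sqrrD.
by rewrite sqrrD; lra.
Qed.

Lemma enormB p (x y : 'cV[R]_p) : enorm (x - y) <= enorm x + enorm y.
Proof. by rewrite -(enormN y) enormD. Qed.

Lemma enorm_sum p (I : finType) (F : I -> 'cV[R]_p) :
  enorm (\sum_i F i) <= \sum_i enorm (F i).
Proof.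
elim/big_rec2: _ => [|i y x _ h]; first by rewrite enorm0.
by apply: le_trans (enormD _ _) _; rewrite lerD2l.
Qed.

Lemma enorm_usubmx p q (z : 'cV[R]_(p + q)) : enorm (usubmx z) <= enorm z.
Proof.
apply: enorm_le; rewrite ?enorm_ge0 // enorm_sqr big_split_ord /=.
rewrite -[leLHS]addr0 lerD ?sumr_ge0 // => [|i _]; last exact: sqr_ge0.
by apply: ler_sum => i _; rewrite mxE.
Qed.

(** Cauchy-Schwarz for (|x_i|) against the vector with all entries 1. *)
Lemma norm1_enorm p (x : 'cV[R]_p) : norm1 x <= Num.sqrt p%:R * enorm x.
Proof.
have n0 : 0 <= norm1 x by apply: sumr_ge0.
rewrite -(ler_pXn2r (n := 2)) // ?nnegrE ?mulr_ge0 ?sqrtr_ge0 ?enorm_ge0 //.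
rewrite exprMn enorm_sqr sqr_sqrtr ?ler0n // /norm1.
have := sum_mul_sqr_le (fun _ : 'I_p => 1) (fun i => `|x i 0|).
rewrite [X in X ^+ 2](eq_bigr (fun i => `|x i 0|)); last by move=> i _; rewrite mul1r.
rewrite expr1n sumr_const card_ord.
rewrite [X in _ * X](eq_bigr (fun i => x i 0 ^+ 2)) //.
by move=> i _; rewrite real_normK ?num_real.
Qed.

Lemma enorm_mulmx_col p q (M : 'M[R]_(p, q)) (c : R) (x : 'cV[R]_q) :
  (forall j, enorm (col j M) <= c) ->
  enorm (M *m x) <= c * norm1 x.
Proof.
move=> hc.
have -> : M *m x = \sum_j x j 0 *: col j M.
  apply/matrixP => i j; rewrite ord1 mxE summxE; apply: eq_bigr => l _.
  by rewrite !mxE mulrC.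
apply: le_trans (enorm_sum _) _; rewrite mulr_sumr; apply: ler_sum => j _.
by rewrite enormZ mulrC ler_wpM2r.
Qed.

(** The image of x combines the columns with the entries of x as weights, and on
    the unit ball the 1-norm is at most sqrt q. *)
Lemma specnorm_le_col p q (M : 'M[R]_(p, q)) (c : R) : 0 <= c ->
  (forall j, enorm (col j M) <= c) -> specnorm M <= Num.sqrt q%:R * c.
Proof.
move=> c0 hc; apply: ge_sup.
  by exists (enorm (M *m 0)); exists 0; rewrite //= enorm0 ler01.
move=> _ [x /= x1 <-]; apply: le_trans (enorm_mulmx_col _ hc) _.
rewrite mulrC ler_wpM2r //; apply: le_trans (norm1_enorm _) _.
by rewrite -[leRHS]mulr1 ler_wpM2l ?sqrtr_ge0.
Qed.

(** [sup] is an upper bound only of bounded sets.  Bounding every column by the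
    sum of the norms of all columns is crude but sufficient for finiteness. *)
Lemma specnorm_has_ubound p q (M : 'M[R]_(p, q)) :
  has_ubound [set enorm (M *m x) | x in [set x : 'cV[R]_q | enorm x <= 1]].
Proof.
have colM j : enorm (col j M) <= \sum_i enorm (col i M).
  by rewrite (bigD1 j) //= lerDl sumr_ge0 // => i _; apply: enorm_ge0.
exists ((\sum_i enorm (col i M)) * Num.sqrt q%:R) => _ [y /= y1 <-].
apply: le_trans (enorm_mulmx_col _ colM) _.
rewrite ler_wpM2l ?sumr_ge0 // => [i _|]; first exact: enorm_ge0.
apply: le_trans (norm1_enorm _) _.
by rewrite -[leRHS]mulr1 ler_wpM2l ?sqrtr_ge0.
Qed.

Lemma specnorm_ge0 p q (M : 'M[R]_(p, q)) : 0 <= specnorm M.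
Proof.
apply: ub_le_sup; first exact: specnorm_has_ubound.
by exists 0; rewrite /= ?mulmx0 enorm0 // ler01.
Qed.

Lemma enorm_mulmx p q (M : 'M[R]_(p, q)) (x : 'cV[R]_q) :
  enorm (M *m x) <= specnorm M * enorm x.
Proof.
have [x0|x0] := eqVneq (enorm x) 0.
  have x_0 : x = 0.
    apply/matrixP => i j; rewrite ord1 mxE; apply/eqP; rewrite -sqrf_eq0.
    have /eqP := enorm_sqr x; rewrite x0 expr0n eq_sym psumr_eq0 => [/allP h|l _].
      by apply: h; rewrite mem_index_enum.
    exact: sqr_ge0.
  by rewrite x0 x_0 mulmx0 enorm0 mulr0.
have xp : 0 < enorm x by rewrite lt0r x0 enorm_ge0.
rewrite -ler_pdivrMr //; apply: ub_le_sup; first exact: specnorm_has_ubound.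
exists ((enorm x)^-1 *: x) => /=.
  by rewrite enormZ ger0_norm ?invr_ge0 ?enorm_ge0 // mulVf.
by rewrite -scalemxAr enormZ ger0_norm ?invr_ge0 ?enorm_ge0 // mulrC.
Qed.

End EuclideanNorm.

(** * Stacked signals and the matrices D and M *)

Section HankelColumns.
Variable R : realType.

(** The stacking convention is that of [hankel], so that a column of a Hankel
    matrix is a stacked window of the signal. *)
Definition block_col m k (s : nat -> 'cV[R]_m) : 'cV[R]_(k * m) :=
  \col_p s (mxtens_unindex p).1 (mxtens_unindex p).2 0.

Lemma col_hankel m T k (u : signal R m T) (j : 'I_(T - k + 1)) :
  col j (hankel k u) = block_col k (fun b => u`_(j + b)).
Proof. by apply/matrixP => p q; rewrite !mxE. Qed.

(** Peeling off the first block matches the splitting of the columns of [Mmx];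
    the cast relies on k.+1 * m being convertible to m + k * m. *)
Lemma block_colS m k (s : nat -> 'cV[R]_m) :
  block_col k.+1 s = col_mx (s 0) (block_col k (fun b => s b.+1)) :> 'cV_(m + k * m).
Proof.
apply/matrixP => p q; rewrite (ord1 q) {q}.
case: (split_ordP p) => i ->; rewrite ?col_mxEu ?col_mxEd !mxE.
  congr (s _ _ _); first by rewrite /= divn_small.
  by apply: val_inj; rewrite /= modn_small.
have m0 : (0 < m)%N by case: {s p} m i => // -[i hi]; exfalso; rewrite muln0 in hi.
congr (s _ _ _); first by rewrite /= divnDl ?dvdnn // divnn m0.
by apply: val_inj; rewrite /= modnDl.
Qed.

Lemma sum_mxtens_index (V : nmodType) k m (F : 'I_(k * m) -> V) :
  \sum_p F p = \sum_a \sum_i F (@mxtens_index k m (a, i)).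
Proof.
rewrite (reindex (@mxtens_index k m)) /=.
  by rewrite pair_bigA /=; apply: eq_bigr => -[].
by exists (@mxtens_unindex k m) => p _; rewrite ?mxtens_indexK ?mxtens_unindexK.
Qed.

Lemma enorm_block_col m k (s : nat -> 'cV[R]_m) (c : R) : 0 <= c ->
  (forall a, (a < k)%N -> enorm (s a) <= c) ->
  enorm (block_col k s) <= Num.sqrt k%:R * c.
Proof.
move=> c0 hs; apply: enorm_le; first by rewrite mulr_ge0 ?sqrtr_ge0.
rewrite exprMn sqr_sqrtr ?ler0n // sum_mxtens_index.
have -> : k%:R * c ^+ 2 = \sum_(a < k) c ^+ 2.
  by rewrite sumr_const card_ord mulr_natl.
apply: ler_sum => a _; apply: le_trans (_ : enorm (s a) ^+ 2 <= _).
  by rewrite enorm_sqr ler_sum // => i _; rewrite mxE mxtens_indexK.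
by rewrite ler_pXn2r ?nnegrE ?enorm_ge0 // hs.
Qed.

Lemma Mmx_block_col n m k (A : 'M[R]_n) (B : 'M[R]_(n, m)) (h : nat -> 'cV[R]_m) :
  Mmx k A B *m block_col k.+1 h =
  col_mx (\sum_(a < k) A ^+ a *m B *m h a.+1) (h 0).
Proof.
rewrite block_colS; apply: etrans (mul_block_col _ _ _ _ _ _) _.
rewrite !mul0mx mul1mx add0r addr0; congr col_mx.
apply/matrixP => i j; rewrite (ord1 j) {j} mxE summxE sum_mxtens_index.
apply: eq_bigr => a _; rewrite [RHS]mxE; apply: eq_bigr => r _.
by rewrite [in LHS]mxE [X in _ * X]mxE mxtens_indexK.
Qed.

(** The entries of the left Kronecker factor of [Dmx] depend on i + j only;
    extending d by zero turns them into a function on all of nat, which makes the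
    shift recursion of [shift_comb_state] free of case distinctions. *)
Definition padded_coef k (d : 'cV[R]_k.+1) (i : nat) : R :=
  if (i <= k)%N then d (inord i) 0 else 0.

(** Block a of D_A applied to the stacked signal f (see [Dmx_block_col]).  With f
    replaced by the powers of a variable z it is sum_b d_(a+b) z^b, the quotient
    of the polynomial d by z^a, that is, an intermediate value of Horner's rule. *)
Definition shift_comb k (d : 'cV[R]_k.+1) p (f : nat -> 'cV[R]_p) (a : nat) : 'cV[R]_p :=
  \sum_(b < k.+1) padded_coef d (a + b) *: f b.

Lemma padded_coef_ord k (d : 'cV[R]_k.+1) (i : 'I_k.+1) : padded_coef d i = d i 0.
Proof. by rewrite /padded_coef -ltnS ltn_ord inord_val. Qed.

Lemma Dmx_block_col m k (d : 'cV[R]_k.+1) (s : nat -> 'cV[R]_m) :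
  Dmx m d *m block_col k.+1 s = block_col k.+1 (shift_comb d s).
Proof.
apply/matrixP => p q; rewrite (ord1 q) {q}; case: (mxtens_indexP p) => a i.
rewrite mxE [RHS]mxE mxtens_indexK /= summxE sum_mxtens_index.
apply: eq_bigr => b _; rewrite [RHS]mxE (bigD1 i) //= big1 ?addr0.
  by rewrite tensmxE !mxE eqxx mulr1 mxtens_indexK.
by move=> r ri; rewrite tensmxE !mxE eq_sym (negPf ri) mulr0 mul0r.
Qed.

(** Each d_i occurs at most once in a given block, so the weights have total
    absolute value at most |d|_1. *)
Lemma enorm_shift_comb k (d : 'cV[R]_k.+1) p (f : nat -> 'cV[R]_p) (c : R) a :
  (forall b, (b <= k)%N -> enorm (f b) <= c) ->
  enorm (shift_comb d f a) <= norm1 d * c.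
Proof.
move=> hf; apply: le_trans (enorm_sum _) _.
have c0 : 0 <= c by apply: le_trans (hf 0 _); rewrite ?enorm_ge0.
apply: le_trans (_ : (\sum_(b < k.+1) `|padded_coef d (a + b)|) * c <= _).
  rewrite mulr_suml; apply: ler_sum => b _; rewrite enormZ ler_wpM2l //.
  by rewrite hf // -ltnS.
rewrite ler_wpM2r // -(big_mkord xpredT (fun b => `|padded_coef d (a + b)|)).
have -> : norm1 d = \sum_(0 <= i < a + k.+1) `|padded_coef d i|.
  rewrite addnC (big_cat_nat (leq0n k.+1)) ?leq_addr //= big_mkord.
  rewrite [X in _ + X]big_nat_cond [X in _ + X]big1 ?addr0.
    by apply: eq_bigr => i _; rewrite padded_coef_ord.
  move=> i /andP[/andP[ki _] _]; rewrite /padded_coef leqNgt ki normr0 //.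
have -> : \sum_(0 <= b < k.+1) `|padded_coef d (a + b)| =
    \sum_(a <= i < a + k.+1) `|padded_coef d i|.
  rewrite -{2}[a]add0n big_addn addKn.
  by apply: eq_bigr => i _; rewrite addnC.
by rewrite (big_cat_nat (leq0n a)) ?leq_addr //= lerDr sumr_ge0.
Qed.

Lemma shift_combD k (d : 'cV[R]_k.+1) p (f g : nat -> 'cV[R]_p) a :
  shift_comb d (fun b => f b + g b) a = shift_comb d f a + shift_comb d g a.
Proof.
by rewrite -big_split; apply: eq_bigr => b _; rewrite scalerDr.
Qed.

Lemma shift_combM k (d : 'cV[R]_k.+1) p q (M : 'M[R]_(q, p)) (f : nat -> 'cV[R]_p) a :
  shift_comb d (fun b => M *m f b) a = M *m shift_comb d f a.
Proof.
by rewrite mulmx_sumr; apply: eq_bigr => b _; rewrite scalemxAr.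
Qed.

(** Elimination of the state: writing S_a(f) for [shift_comb d f a], the state
    equation gives the Horner recursion
    S_a(x) = d_a x(0) + A S_(a+1)(x) + S_(a+1)(v).  Unfolding it k+1 times from
    a = 0 collects (sum_a d_a A^a) x(0), which vanishes, and a remainder
    A^(k+1) S_(k+1)(x) that is zero because the coefficients stop at k. *)
Lemma shift_comb_state n k (d : 'cV[R]_k.+1) (A : 'M[R]_n.+1) (x v : nat -> 'cV[R]_n.+1) :
  \sum_(i < k.+1) d i 0 *: A ^+ i = 0 ->
  (forall b, (b < k)%N -> x b.+1 = A *m x b + v b) ->
  shift_comb d x 0 = \sum_(a < k) A ^+ a *m shift_comb d v a.+1.
Proof.
move=> dA xv.
have step a : shift_comb d x a =
    padded_coef d a *: x 0 + A *m shift_comb d x a.+1 + shift_comb d v a.+1.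
  rewrite -shift_combM -addrA -shift_combD /shift_comb big_ord_recl addn0.
  (* The term b = k of the shifted sum carries the coefficient d_(a+1+k) = 0;
     the remaining terms use the state equation at times b < k. *)
  rewrite [X in _ = _ + X]big_ord_recr /= [padded_coef d (a.+1 + k)]/padded_coef.
  rewrite ltnNge leq_addl /= scale0r addr0; congr (_ + _).
  by apply: eq_bigr => b _; rewrite /= addSnnS xv.
have unfold r : shift_comb d x 0 =
    (\sum_(a < r) padded_coef d a *: A ^+ a) *m x 0 +
    \sum_(a < r) A ^+ a *m shift_comb d v a.+1 + A ^+ r *m shift_comb d x r.
  elim: r => [|r IH]; first by rewrite !big_ord0 mul0mx !add0r expr0 mul1mx.
  rewrite IH !big_ord_recr /= [in LHS]step !mulmxDr !mulmxDl exprSr -mulmxE -!mulmxA.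
  rewrite -scalemxAr -scalemxAl.
  by rewrite [LHS](AC (2*(2*1)) ((1*3)*(2*5)*4)).
have out f : shift_comb d f k.+1 = 0 :> 'cV[R]_n.+1.
  by apply: big1 => b _; rewrite /padded_coef ltnNge leq_addr scale0r.
rewrite (unfold k.+1) out mulmx0 addr0 [X in _ + X]big_ord_recr /= out mulmx0 addr0.
rewrite (eq_bigr (fun a : 'I_k.+1 => d a 0 *: A ^+ a)) => [|a _].
  by rewrite dA mul0mx add0r.
by rewrite padded_coef_ord.
Qed.

End HankelColumns.

(** * Universality of the input *)

(* The state dimension is n = n'.+1, since 1 <= k <= n forces n >= 1. *)
Theorem theorem29 (R : realType) (n' m : nat) (eps : R)
    (Spk : set (system R n'.+1 m)) (k T : nat)
    (d : 'M[R]_n'.+1 -> 'cV[R]_k.+1) (u : signal R m T) :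
  0 <= eps ->
  Spk !=set0 ->
  uniformly_discrete Spk ->
  (1 <= k <= n'.+1)%N ->
  Spk `<=` Sigma_deg k ->
  annihilator_choice d ->
  (k.+1 <= T)%N ->
  (forall (A : 'M[R]_n'.+1) (B : 'M[R]_(n'.+1, m))
          (F : 'M[R]_n'.+1) (G : 'M[R]_(n'.+1, m)),
     Spk (A, B) -> differences Spk (F, G) -> (F, G) != 0 ->
     specnorm (row_mx F G *m Mmx k A B *m Dmx m (d A) *m hankel k.+1 u)
     > eps * Num.sqrt T%:R * norm1 (d A) *
       (2 + specnorm (Mmx k A 1%:M) * specnorm F *
            Num.sqrt (n'.+1 + 1)%:R)) ->
  universal eps Spk u.
Proof.
move=> eps0 _ _ /andP[_ kn] Spk_deg hd kT excited [u' x] [[A B] SAB [bAB /= u'u]].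
subst u'; exists (A, B); apply/seteqP; split=> [[A' B'] [bAB' SAB']|_ -> //].
apply/eqP; rewrite -subr_eq0; apply: contraT => neq.
have [dA _ _] := hd A (Spk_deg _ SAB).
have := excited A B (A' - A) (B' - B) SAB _ neq.
move/(_ (ex_intro2 _ _ (A', B') SAB' (ex_intro2 _ _ (A, B) SAB erefl))).
rewrite ltNge => /negP[].
set F := A' - A; set G := B' - B.
have [w hw] := bAB; have [w' hw'] := bAB'.
apply: le_trans (specnorm_le_col (c := norm1 (d A) * (2 * eps) +
    specnorm F * (specnorm (Mmx k A 1%:M) *
      (Num.sqrt k.+1%:R * (norm1 (d A) * eps)))) _ _) _.
- by rewrite addr_ge0 ?mulr_ge0 ?specnorm_ge0 ?sqrtr_ge0 ?sumr_ge0.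
- move=> j.
  have jT b : (b <= k)%N -> (j + b < T)%N by have := ltn_ord j; lia.
  pose wj b := w`_(j + b); pose uj b := u`_(j + b); pose xj b := x`_(j + b).
  pose vj b := B *m uj b + wj b.
  have wj_le b : (b <= k)%N -> enorm (wj b) <= eps.
    by move=> /jT /hw [].
  (* Both systems produce the same next state, so F x + G u is the difference of
     the two disturbances. *)
  have e_le b : (b <= k)%N -> enorm (F *m xj b + G *m uj b) <= 2 * eps.
    move=> /jT bT; have [w_le xw] := hw _ bT; have [w'_le xw'] := hw' _ bT.
    have -> : F *m xj b + G *m uj b = w`_(j + b) - w'`_(j + b).
      have /= eq_next := etrans (esym xw') xw.
      rewrite !mulmxBl addrACA -opprD -[X in X - _](addrK w'`_(j + b)) eq_next.
      by rewrite addrAC; congr (_ - _); rewrite addrAC subrr add0r.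
    apply: le_trans (enormB _ _) _; lra.
  have state : shift_comb (d A) xj 0 =
      \sum_(a < k) A ^+ a *m shift_comb (d A) vj a.+1.
    apply: shift_comb_state => // b /ltnW/jT/hw [_ /= xw].
    by rewrite /xj /vj addnS xw -addrA.
  (* The state is driven by v = B u + w: adding and subtracting the part due to w
     turns the input expansion into F x + G u minus a pure disturbance term. *)
  have -> : col j (row_mx F G *m Mmx k A B *m Dmx m (d A) *m hankel k.+1 u) =
      shift_comb (d A) (fun b => F *m xj b + G *m uj b) 0 -
      F *m usubmx (Mmx k A 1%:M *m block_col k.+1 (shift_comb (d A) wj)).
    rewrite colE -!mulmxA -colE col_hankel Dmx_block_col !Mmx_block_col.
    rewrite mul_row_col col_mxKu shift_combD !shift_combM state /vj.
    rewrite addrAC -mulmxBr -sumrB; congr (_ *m _ + _); apply: eq_bigr => a _.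
    by rewrite shift_combD shift_combM mulmxDr mulmx1 addrK mulmxA.
  apply: le_trans (enormB _ _) _; apply: lerD; first exact: enorm_shift_comb.
  apply: le_trans (enorm_mulmx _ _) _; rewrite ler_wpM2l ?specnorm_ge0 //.
  apply: le_trans (enorm_usubmx _) _.
  apply: le_trans (enorm_mulmx _ _) _; rewrite ler_wpM2l ?specnorm_ge0 //.
  apply: enorm_block_col => [|a _]; first by rewrite mulr_ge0 ?sumr_ge0.
  exact: enorm_shift_comb.
have sT : Num.sqrt (T - k.+1 + 1)%:R <= Num.sqrt T%:R :> R.
  by rewrite ler_wsqrtr // ler_nat; lia.
have sk : Num.sqrt k.+1%:R <= Num.sqrt (n'.+1 + 1)%:R :> R.
  by rewrite ler_wsqrtr // ler_nat addn1 ltnS.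
have d0 : 0 <= norm1 (d A) by apply: sumr_ge0.
have -> : eps * Num.sqrt T%:R * norm1 (d A) * (2 + specnorm (Mmx k A 1%:M) *
      specnorm F * Num.sqrt (n'.+1 + 1)%:R) =
    Num.sqrt T%:R * (norm1 (d A) * (2 * eps) + specnorm F *
      (specnorm (Mmx k A 1%:M) * (Num.sqrt (n'.+1 + 1)%:R * (norm1 (d A) * eps)))).
  by ring.
apply: ler_pM => //.
- exact: sqrtr_ge0.
- by rewrite addr_ge0 ?mulr_ge0 ?specnorm_ge0 ?sqrtr_ge0.
rewrite lerD2l; do 2![rewrite ler_wpM2l ?specnorm_ge0 //].
by rewrite ler_wpM2r // mulr_ge0.
Qed.
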